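(* Let $\mathcal U$ be the set of unimodal bargraphs with a centered maximum. The generating function for these bargraphs with respect to the number of $E$ and $N$ steps and the degree of symmetry is $$\sum_{B\in\mathcal U}s^{\mathrm{ds}(B)}x^{e(B)}y^{n(B)}=\frac{y(1+x-y)}{(1-s)x^2+\sqrt{((x+1)^2-y)((x-1)^2-y)}}-y.$$
   Context: A composition is a sequence of positive integers $(a_1,\dots,a_k)$ with $k\ge1$. It is represented as a bargraph $B$: $k$ bottom-justified columns of unit boxes, where column $i$ from the left has $a_i$ boxes. A bargraph is identified with the lattice path given by its upper boundary, a self-avoiding path with steps $N=(0,1)$, $E=(1,0)$, $S=(0,-1)$ starting at the origin and returning to the $x$-axis only at the end. $e(B)$ is the number of $E$ steps (so $e(B)=k$) and $n(B)$ is the number of $N$ steps of this path. The degree of symmetry $\mathrm{ds}(B)$ is the number of indices $1\le i\le k/2$ with $a_i=a_{k+1-i}$. A unimodal bargraph with a centered maximum is one whose column heights satisfy $1\le a_1\le a_2\le\dots\le a_{\lfloor (k+1)/2\rfloor}$ and $a_{\lceil (k+1)/2\rceil}\ge\dots\ge a_{k-1}\ge a_k\ge1$. The identity is between formal power series in $x,y$ with coefficients polynomials in $s$, with the square root being the power series with constant term $1$. *)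

(* Defs.v *)
From HB Require Import structures.
From mathcomp Require Import all_boot all_order all_algebra.
From mathcomp Require Import boolp classical_sets fsbigop.

Set Implicit Arguments.
Unset Strict Implicit.
Unset Printing Implicit Defensive.

Import GRing.Theory.
Local Open Scope ring_scope.

Record fps (R : Type) := Fps { fps_coef :> nat -> R }.

Lemma fpsP (R : Type) (f g : fps R) : f =1 g -> f = g.
Proof. by case: f g => [f] [g] /= /funext->. Qed.

HB.instance Definition _ (R : Type) := gen_eqMixin (fps R).
HB.instance Definition _ (R : Type) := gen_choiceMixin (fps R).

Section PowerSeriesRing.
Variable R : comUnitRingType.
Implicit Types f g h : fps R.

Definition fps_const (c : R) : fps R := Fps (fun n => if n is 0 then c else 0).
Definition fps_X : fps R := Fps (fun n => (n == 1)%:R).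

Definition fps_add f g : fps R := Fps (fun n => f n + g n).
Definition fps_opp f : fps R := Fps (fun n => - f n).
Definition fps_mul f g : fps R :=
  Fps (fun n => \sum_(i < n.+1) f i * g (n - i)%N).

Fact fps_addA : associative fps_add.
Proof. by move=> f g h; apply: fpsP => n /=; rewrite addrA. Qed.
Fact fps_addC : commutative fps_add.
Proof. by move=> f g; apply: fpsP => n /=; rewrite addrC. Qed.
Fact fps_add0 : left_id (fps_const 0) fps_add.
Proof. by move=> f; apply: fpsP => -[|n] /=; rewrite add0r. Qed.
Fact fps_addN : left_inverse (fps_const 0) fps_opp fps_add.
Proof. by move=> f; apply: fpsP => -[|n] /=; rewrite addNr. Qed.

HB.instance Definition _ :=
  GRing.isZmodule.Build (fps R) fps_addA fps_addC fps_add0 fps_addN.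

Let trunc N f : {poly R} := \poly_(i < N) f i.

Let fps_mul_trunc N f g n : (n < N)%N ->
  fps_mul f g n = (trunc N f * trunc N g)`_n.
Proof.
move=> ltnN; rewrite coefM; apply: eq_bigr => i _.
by rewrite !coef_poly (leq_ltn_trans (leq_ord i)) // (leq_ltn_trans (leq_subr _ _)).
Qed.

Let coefM_eq (p p' q q' : {poly R}) n :
    (forall i, (i <= n)%N -> p`_i = p'`_i) ->
    (forall i, (i <= n)%N -> q`_i = q'`_i) -> (p * q)`_n = (p' * q')`_n.
Proof.
move=> pp' qq'; rewrite !coefM; apply: eq_bigr => i _.
by rewrite pp' ?leq_ord // qq' ?leq_subr.
Qed.

Fact fps_mulA : associative fps_mul.
Proof.
move=> f g h; apply: fpsP => n.
rewrite !(@fps_mul_trunc n.+1) //.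
transitivity ((trunc n.+1 f * (trunc n.+1 g * trunc n.+1 h))`_n).
  apply: coefM_eq => // i le_in.
  by rewrite coef_poly ltnS le_in (@fps_mul_trunc n.+1).
rewrite mulrA; apply: coefM_eq => // i le_in.
by rewrite coef_poly ltnS le_in (@fps_mul_trunc n.+1).
Qed.
Fact fps_mulC : commutative fps_mul.
Proof.
by move=> f g; apply: fpsP => n; rewrite !(@fps_mul_trunc n.+1) // mulrC.
Qed.
Fact fps_mul1 : left_id (fps_const 1) fps_mul.
Proof.
move=> f; apply: fpsP => n /=.
by rewrite big_ord_recl /= mul1r subn0 big1 ?addr0 // => i _; rewrite mul0r.
Qed.
Fact fps_mulDl : left_distributive fps_mul fps_add.
Proof.
move=> f g h; apply: fpsP => n /=; rewrite -big_split /=.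
by apply: eq_bigr => i _; rewrite mulrDl.
Qed.
Fact fps_1neq0 : fps_const 1 != 0.
Proof. by apply/eqP => /(congr1 (fun f : fps R => f 0)) /eqP; rewrite oner_eq0. Qed.

HB.instance Definition _ := GRing.Zmodule_isComNzRing.Build (fps R)
  fps_mulA fps_mulC fps_mul1 fps_mulDl fps_1neq0.

(* The recurrence g_n = (delta_(n,0) - sum_(i < n) f_(n-i) g_i) / f_0 for the
   coefficients of g = 1 / f; [fps_inv_seq f n] lists g_0, ..., g_(n-1). *)
Fixpoint fps_inv_seq f (n : nat) : seq R :=
  if n is m.+1 then
    let s := fps_inv_seq f m in
    rcons s (((m == 0)%:R - \sum_(i < m) f (m - i)%N * s`_i) / f 0)
  else [::].

Definition fps_unit : {pred fps R} := fun f => f 0 \is a GRing.unit.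

(* As everywhere in the library, the inverse of a non-unit is itself. *)
Definition fps_inv f : fps R :=
  if f \in fps_unit then Fps (fun n => (fps_inv_seq f n.+1)`_n) else f.

Let size_fps_inv_seq f n : size (fps_inv_seq f n) = n.
Proof. by elim: n => //= n IHn; rewrite size_rcons IHn. Qed.

Let nth_fps_inv_seq f m i : (i < m)%N ->
  (fps_inv_seq f m)`_i = (fps_inv_seq f i.+1)`_i.
Proof.
elim: m => // m IHm; rewrite ltnS leq_eqVlt => /predU1P[-> //|ltim].
by rewrite -IHm //= nth_rcons size_fps_inv_seq ltim.
Qed.

Fact fps_mulVx : {in fps_unit, left_inverse 1 fps_inv *%R}.
Proof.
move=> f Uf; apply: fpsP => n; rewrite /fps_inv Uf.
transitivity ((n == 0)%:R : R); last by case: n.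
rewrite /GRing.mul /= -/GRing.mul big_ord_recr /= subnn.
rewrite nth_rcons size_fps_inv_seq ltnn eqxx divrK // addrC.
set u := \sum_(i < n) _; set v := \sum_(i < n) _; suff ->: v = u by rewrite subrK.
apply: eq_bigr => i _; rewrite mulrC; congr (_ * _).
by rewrite nth_fps_inv_seq.
Qed.
Fact fps_unitPl f g : g * f = 1 -> f \in fps_unit.
Proof.
move=> /(congr1 (fun h : fps R => h 0)).
rewrite /GRing.mul /= big_ord_recl big_ord0 addr0 subn0 => gf1.
by apply/unitrPr; exists (g 0); rewrite mulrC.
Qed.
Fact fps_inv_out : {in [predC fps_unit], fps_inv =1 id}.
Proof. by move=> f; rewrite inE /fps_inv => /negbTE->. Qed.

HB.instance Definition _ := GRing.ComNzRing_hasMulInverse.Build (fps R)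
  fps_mulVx fps_unitPl fps_inv_out.

End PowerSeriesRing.

(* Power series in x and y with coefficients polynomials in s: for
   [f : series_xy], [f i j] is the coefficient of x^i y^j. *)
Definition series_xy := fps (fps {poly rat}).
HB.instance Definition _ := GRing.ComUnitRing.on series_xy.

Definition var_x : series_xy := fps_X (fps {poly rat}).
Definition var_y : series_xy := fps_const (fps_X {poly rat}).
Definition var_s : series_xy := fps_const (fps_const 'X).

(* The sum of a possibly infinite family, coefficient by coefficient. It is
   meaningful when for each i and j only finitely many a in A have
   (F a) i j != 0 (a sum with infinite support is 0 by convention). *)
Definition series_sum (T : choiceType) (A : set T) (F : T -> series_xy) :
    series_xy :=
  Fps (fun i => Fps (fun j => \sum_(a \in A) (F a : series_xy) i j)).

Local Open Scope nat_scope.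

Definition composition (a : seq nat) : Prop :=
  a <> [::] /\ all (leq 1) a.

(* Column heights are numbered from 1. *)
Definition column (a : seq nat) (i : nat) : nat := nth 0 a i.-1.

Inductive step := StepN | StepE | StepS.
Definition is_N (t : step) := if t is StepN then true else false.
Definition is_E (t : step) := if t is StepE then true else false.

(* The path from height h running over the columns in a and then going back
   down to the x-axis; of the two vertical runs before an E step, at least one
   is empty because subtraction is truncated. *)
Fixpoint boundary_from (h : nat) (a : seq nat) : seq step :=
  if a is b :: a' then
    nseq (b - h) StepN ++ nseq (h - b) StepS ++ StepE :: boundary_from b a'
  else nseq h StepS.

Definition boundary (a : seq nat) : seq step := boundary_from 0 a.

Definition num_E (a : seq nat) : nat := count is_E (boundary a).
Definition num_N (a : seq nat) : nat := count is_N (boundary a).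

Definition deg_sym (a : seq nat) : nat :=
  count (fun i => column a i == column a ((size a).+1 - i))
        (iota 1 (size a)./2).

(* With k = size a, (k.+1)./2 and uphalf k.+1 are the floor and the ceiling
   of (k + 1) / 2. *)
Definition centered_unimodal (a : seq nat) : Prop :=
  [/\ composition a,
      forall i, 1 <= i < (size a).+1./2 -> column a i <= column a i.+1 &
      forall i, uphalf (size a).+1 <= i < size a ->
        column a i.+1 <= column a i].

Definition centered_unimodal_gf : series_xy :=
  series_sum [set a | centered_unimodal a]%classic
    (fun a => var_s ^+ deg_sym a * var_x ^+ num_E a * var_y ^+ num_N a)%R.

(* Main.v *)
Require Import Defs.
From mathcomp Require Import all_boot all_order all_algebra.
From mathcomp Require Import classical_sets fsbigop.
From mathcomp Require Import ring zify.
Import GRing.Theory Num.Theory.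
Local Open Scope ring_scope.

(* Read a centered unimodal bargraph from the outside in: its columns form a
   pair of weakly increasing sequences, plus a central column in odd length.
   Let F be the series in z = x ^ 2 and y whose coefficient of z ^ m y ^ n is
   the sum of s ^ #{i | l_i = r_i} over the pairs (l, r) of such sequences of
   length m with values in {0, ..., n}. Since the number of N steps is the
   height of the highest column, the wanted series is y (1 - y + x) F - y.
   At s = 1, F is G = sum 'C(m + n, m) ^ 2 z ^ m y ^ n. Writing s = 1 + (s - 1)
   and cutting a pair at its last marked symmetric index gives
   F = G + (s - 1) z F G, so F = 1 / (1 / G + (1 - s) z).
   Finally G satisfies a first-order differential equation in z forcing
   G ^ 2 ((1 - y) ^ 2 - 2 z (1 + y) + z ^ 2) = 1,
   so 1 / G is the square root. *)

Set Implicit Arguments.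
Unset Strict Implicit.
Unset Printing Implicit Defensive.

(** * Power series *)

Section PowerSeries.
Variable R : comUnitRingType.
Implicit Types (f g : fps R) (c : R).

Lemma fps_coefD f g n : (f + g) n = f n + g n. Proof. by []. Qed.

Lemma fps_coefN f n : (- f) n = - f n. Proof. by []. Qed.

Lemma fps_coef0 n : (0 : fps R) n = 0. Proof. by case: n. Qed.

Lemma fps_coef_sum k (F : 'I_k -> fps R) n : (\sum_i F i) n = \sum_i F i n.
Proof.
apply: (big_ind2 (fun (f : fps R) c => f n = c)) => //; first exact: fps_coef0.
by move=> f _ g _ <- <-.
Qed.

Lemma fps_coefMn f k n : (f *+ k) n = f n *+ k.
Proof. by elim: k => [|k IHk]; [case: n | rewrite !mulrS fps_coefD IHk]. Qed.

Lemma fps_coef1 n : (1 : fps R) n = (n == 0)%:R. Proof. by case: n. Qed.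

Lemma fps_coefM f g n : (f * g) n = \sum_(i < n.+1) f i * g (n - i)%N.
Proof. by []. Qed.

Lemma fps_coef_constM c f n : (fps_const c * f) n = c * f n.
Proof.
rewrite fps_coefM big_ord_recl /= subn0 big1 ?addr0 // => i _.
by rewrite mul0r.
Qed.

Lemma fps_coef_XM f n : (fps_X R * f) n = if n is n'.+1 then f n' else 0.
Proof.
rewrite fps_coefM big_ord_recl /= mul0r add0r.
case: n => [|n]; first by rewrite big_ord0.
rewrite big_ord_recl /= mul1r subn1 big1 ?addr0 // => i _.
by rewrite mul0r.
Qed.

Lemma fps_coef_XM0 f : (fps_X R * f) 0%N = 0.
Proof. by rewrite fps_coef_XM. Qed.

Lemma fps_coef_XMS f n : (fps_X R * f) n.+1 = f n.
Proof. by rewrite fps_coef_XM. Qed.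

Lemma fps_constD c d : fps_const (c + d) = fps_const c + fps_const d.
Proof. by apply: fpsP => -[|n]; rewrite fps_coefD //= addr0. Qed.

Lemma fps_constN c : fps_const (- c) = - fps_const c.
Proof. by apply: fpsP => -[|n]; rewrite fps_coefN //= oppr0. Qed.

Lemma fps_constM c d : fps_const (c * d) = fps_const c * fps_const d.
Proof.
by apply: fpsP => -[|n]; rewrite fps_coef_constM //= mulr0.
Qed.

Lemma fps_const1 : fps_const (1 : R) = 1. Proof. by []. Qed.

Lemma fps_coef_XnM f e n :
  (fps_X R ^+ e * f) n = if (e <= n)%N then f (n - e)%N else 0.
Proof.
elim: e n => [|e IHe] n; first by rewrite mul1r subn0.
rewrite exprS -mulrA; case: n => [|n]; first by rewrite fps_coef_XM0.
by rewrite fps_coef_XMS IHe.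
Qed.

Lemma fps_const_exp c n : fps_const (c ^+ n) = fps_const c ^+ n.
Proof. by elim: n => [|n IHn] //; rewrite !exprS fps_constM IHn. Qed.

Lemma fps_unitE f : (f \is a GRing.unit) = (f 0%N \is a GRing.unit).
Proof. by []. Qed.

(* The Euler operator [X d/dX]. *)
Definition fps_theta f : fps R := Fps (fun n => f n *+ n).

Lemma fps_coef_theta f n : fps_theta f n = f n *+ n. Proof. by []. Qed.

Lemma fps_thetaM f g : fps_theta (f * g) = fps_theta f * g + f * fps_theta g.
Proof.
apply: fpsP => n; rewrite fps_coefD fps_coef_theta !fps_coefM.
rewrite -sumrMnl -big_split.
apply: eq_bigr => i _; rewrite !fps_coef_theta.
by rewrite /= mulrnAl mulrnAr -mulrnDr subnKC // -ltnS.
Qed.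

Lemma fps_theta_const c : fps_theta (fps_const c) = 0.
Proof. by apply: fpsP => -[|n]; rewrite fps_coef_theta ?mul0rn. Qed.

Lemma fps_theta_X : fps_theta (fps_X R) = fps_X R.
Proof. by apply: fpsP => -[|[|n]]; rewrite fps_coef_theta ?mul0rn. Qed.

Lemma fps_thetaD f g : fps_theta (f + g) = fps_theta f + fps_theta g.
Proof. by apply: fpsP => n; rewrite fps_coefD !fps_coef_theta mulrnDl. Qed.

(** The first hypothesis is absence of additive torsion: the coefficient of degree [n.+1] is
    multiplied by [n.+1], so only the constant one can survive. *)
Lemma fps_theta_eq0 f :
  (forall (r : R) n, r *+ n.+1 = 0 -> r = 0) ->
  fps_theta f = 0 -> f = fps_const (f 0%N).
Proof.
move=> charR0 tf0; apply: fpsP => -[|n] //=.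
exact: charR0 (congr1 (fun h : fps R => h n.+1) tf0).
Qed.

(* The substitution of [X ^ 2] for [X]. *)
Definition fps_dilate f : fps R :=
  Fps (fun n => if odd n then 0 else f n./2).

Lemma fps_coef_dilate f n :
  fps_dilate f n = if odd n then 0 else f n./2.
Proof. by []. Qed.

Lemma fps_dilate_doubleE f m : fps_dilate f m.*2 = f m.
Proof. by rewrite /= odd_double doubleK. Qed.

Lemma fps_dilate_oddE f m : fps_dilate f m.*2.+1 = 0.
Proof. by rewrite /= odd_double. Qed.

Lemma fps_parityP f g : (forall m, f m.*2 = g m.*2) ->
  (forall m, f m.*2.+1 = g m.*2.+1) -> f = g.
Proof.
move=> ev od; apply: fpsP => n; rewrite -(odd_double_half n).
by case: (odd n); [exact: od | exact: ev].
Qed.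

Lemma fps_dilateD f g : fps_dilate (f + g) = fps_dilate f + fps_dilate g.
Proof.
by apply: fpsP => n; rewrite !(fps_coefD, fps_coef_dilate); case: odd;
  rewrite ?addr0.
Qed.

Lemma fps_dilateN f : fps_dilate (- f) = - fps_dilate f.
Proof.
by apply: fpsP => n; rewrite !(fps_coefN, fps_coef_dilate); case: odd;
  rewrite ?oppr0.
Qed.

Lemma fps_dilate_const c : fps_dilate (fps_const c) = fps_const c.
Proof. by apply: fpsP => -[|[|n]] //=; case: odd. Qed.

Lemma fps_dilate_X : fps_dilate (fps_X R) = fps_X R ^+ 2.
Proof.
apply: fpsP => -[|[|[|[|n]]]]; rewrite expr2 fps_coef_XM ?fps_coef_XM //=.
by case: odd.
Qed.

Lemma sum_doubleS (F : nat -> R) m :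
  \sum_(i < m.*2.+1) F i = \sum_(i < m.+1) F i.*2 + \sum_(i < m) F i.*2.+1.
Proof.
elim: m => [|m IHm]; first by rewrite !big_ord_recr !big_ord0 /= addr0.
rewrite doubleS 2!big_ord_recr /= IHm [in RHS]big_ord_recr /=.
by rewrite [X in _ = _ + X]big_ord_recr /=; ring.
Qed.

(** In an even coefficient only products of two even-indexed terms survive; in an odd one, one of
    the two indices is always odd. *)
Lemma fps_dilateM f g : fps_dilate (f * g) = fps_dilate f * fps_dilate g.
Proof.
apply: fps_parityP => m.
  rewrite fps_dilate_doubleE !fps_coefM.
  rewrite (sum_doubleS (fun i => fps_dilate f i * fps_dilate g (m.*2 - i)%N)).
  rewrite [X in _ = _ + X]big1 ?addr0; last first.
    by move=> i _; rewrite fps_dilate_oddE mul0r.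
  by apply: eq_bigr => i _; rewrite -doubleB !fps_dilate_doubleE.
rewrite fps_dilate_oddE fps_coefM big1 // => i _.
have [oi|ei] := boolP (odd i); first by rewrite /= oi mul0r.
suff oi : odd (m.*2.+1 - i)%N by rewrite /= oi mulr0.
by rewrite oddB ?(ltnW (ltn_ord _)) //= ?odd_double ?(negbTE ei) // -ltnS.
Qed.

(** Turns a three-term recurrence with its two initial cases into an identity of series; this is how
    the differential equation is obtained. *)
Lemma fps_eq_quadM (a b c d e k : R) f g :
  a * f 0%N = d * g 0%N ->
  a * f 1%N + b * f 0%N = d * g 1%N + e * g 0%N ->
  (forall n, a * f n.+2 + b * f n.+1 + c * f n =
     d * g n.+2 + e * g n.+1 + k * g n) ->
  (fps_const a + fps_X R * fps_const b + fps_X R * fps_X R * fps_const c) * f =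
  (fps_const d + fps_X R * fps_const e + fps_X R * fps_X R * fps_const k) * g.
Proof.
move=> E0 E1 E2; rewrite !mulrDl -!mulrA; apply: fpsP => n.
rewrite !fps_coefD !fps_coef_constM.
case: n => [|n]; first by rewrite !fps_coef_XM0 !addr0.
rewrite !fps_coef_XMS !fps_coef_constM.
case: n => [|n]; first by rewrite !fps_coef_XM0 !addr0.
by rewrite !fps_coef_XMS !fps_coef_constM.
Qed.

End PowerSeries.

(** * Squared binomial coefficients and the square root *)

Definition bin_sq (m n : nat) : nat := 'C(m + n, m) ^ 2.

Lemma bin_factr m n :
  'C(m + n, m)%:R = (m + n)`!%:R / (m`!%:R * n`!%:R) :> rat.
Proof.
apply: (canRL (mulfK _)); last first.
  by rewrite -!natrM -(bin_fact (leq_addr n m)) addKn.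
by rewrite mulf_neq0 // pnatr_eq0 -lt0n fact_gt0.
Qed.

(* The junk value [m.-1 = 0] at [m = 0] is harmless: its coefficient is [m]. *)
Lemma bin_sq_rec m n :
  (m.+1 * (bin_sq m.+1 n.+2 + bin_sq m.+1 n) + m * bin_sq m.-1 n.+2 =
   m.*2.+1 * (bin_sq m n.+2 + bin_sq m n.+1) + 2 * m.+1 * bin_sq m.+1 n.+1)%N.
Proof.
rewrite /bin_sq -addnn; case: m => [|m].
  by rewrite !bin1 !bin0 -!mulnn; lia.
(* An abstract [fa] keeps [natrD] from unfolding factorials. *)
have [fa [fa0 faS binE]] : exists fa : nat -> rat,
    [/\ forall k, fa k != 0, forall k, fa k.+1 = (1 + k%:R) * fa k &
        forall a b, 'C(a + b, a)%:R = fa (a + b)%N / (fa a * fa b)].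
  exists (fun k => k`!%:R); split; last exact: bin_factr.
    by move=> k; rewrite pnatr_eq0 -lt0n fact_gt0.
  by move=> k; rewrite factS natrM mulrS.
apply/eqP; rewrite -(eqr_nat rat); apply/eqP.
rewrite succnK !(binE, natrX, natrD, natrM) !(addSn, addnS) !faS.
rewrite !(mulrS, natrD); field.
by rewrite !fa0 -!mulrS !pnatr_eq0.
Qed.

Local Notation Y := (fps_X {poly rat}).
Local Notation Z := (fps_X (fps {poly rat})).

Definition bin_sq_gf : fps (fps {poly rat}) :=
  Fps (fun m => Fps (fun n => (bin_sq m n)%:R)).

Lemma bin_sq0n n : bin_sq 0 n = 1%N. Proof. by rewrite /bin_sq bin0. Qed.

Lemma bin_sqn0 m : bin_sq m 0 = 1%N. Proof. by rewrite /bin_sq addn0 binn. Qed.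

Lemma bin_sqn1 m : bin_sq m 1 = (m.+1 ^ 2)%N.
Proof. by rewrite /bin_sq addn1 binSn. Qed.

Lemma bin_sq_gf_coef m n : bin_sq_gf m n = (bin_sq m n)%:R. Proof. by []. Qed.

(** [bin_sq_rec] summed over [n]. With P_m the Legendre polynomials, [bin_sq_gf m] is P_m((1 + Y) /
    (1 - Y)) / (1 - Y) ^ (m + 1), and this is Bonnet's recurrence for P_m. *)
Lemma bin_sq_gf_rec m :
  (1 - Y) ^+ 2 * bin_sq_gf m.+1 *+ m.+1 + bin_sq_gf m.-1 *+ m =
  (1 + Y) * bin_sq_gf m *+ m.*2.+1.
Proof.
have e1 g : (1 - Y) ^+ 2 * g = g - (Y * g) *+ 2 + Y * (Y * g) by ring.
have e2 g : (1 + Y) * g = g + Y * g by ring.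
rewrite e1 e2; apply: fpsP => n.
rewrite !(fps_coefD, fps_coefMn, fps_coefN).
case: n => [|[|n]]; rewrite !(fps_coef_XM0, fps_coef_XMS) !bin_sq_gf_coef.
- by rewrite !bin_sqn0 -addnn; ring.
- rewrite !bin_sqn0 !bin_sqn1 addr0 !natrX -addnn; case: m => [|m].
    by rewrite mulr0n; ring.
  by rewrite succnK; ring.
move: (bin_sq_rec m n) => /(congr1 (fun k => k%:R : {poly rat})).
move: (bin_sq m.+1 n.+2) (bin_sq m.+1 n) (bin_sq m.-1 n.+2) => b1 b2 b3.
move: (bin_sq m n.+2) (bin_sq m n.+1) (bin_sq m.+1 n.+1) => b4 b5 b6.
move=> /eqP; rewrite -subr_eq0 => E; apply/eqP; rewrite -subr_eq0 -(eqP E).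
by rewrite -addnn; apply/eqP; ring.
Qed.

Lemma bin_sq_gf0 : (1 - Y) * bin_sq_gf 0%N = 1.
Proof.
rewrite mulrBl mul1r; apply: fpsP => -[|n]; rewrite fps_coefD fps_coefN.
  by rewrite fps_coef_XM0 bin_sq_gf_coef bin_sq0n subr0.
by rewrite fps_coef_XMS !bin_sq_gf_coef !bin_sq0n subrr.
Qed.

(* The radicand with [Z] in place of [x ^ 2]; [fps_dilate] substitutes back. *)
Definition radicand : fps (fps {poly rat}) :=
  fps_const ((1 - Y) ^+ 2) - Z * fps_const (2 * (1 + Y)) + Z * Z.

(** The differential equation for G: its coefficient of degree [m.+1] in [Z] is
    [bin_sq_gf_rec m]. *)
Lemma radicand_theta_bin_sq_gf :
  radicand * fps_theta bin_sq_gf = Z * (fps_const (1 + Y) - Z) * bin_sq_gf.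
Proof.
have -> : radicand = fps_const ((1 - Y) ^+ 2) +
    Z * fps_const (- (2 * (1 + Y))) + Z * Z * fps_const 1.
  by rewrite /radicand fps_constN fps_const1; ring.
have -> : Z * (fps_const (1 + Y) - Z) = fps_const 0 + Z * fps_const (1 + Y) +
    Z * Z * fps_const (- 1).
  have -> : fps_const (0 : fps {poly rat}) = 0 by [].
  by rewrite fps_constN fps_const1; ring.
apply: fps_eq_quadM => [||n]; rewrite !fps_coef_theta.
- by rewrite mulr0n mul0r mulr0.
- move: (bin_sq_gf_rec 0); rewrite mulr0n addr0 -mulrnAr => ->.
  by rewrite double0 mulr1n mulr0 mul0r addr0 add0r.
move: (bin_sq_gf_rec n.+1); rewrite succnK => /eqP; rewrite -subr_eq0 => E.
apply/eqP; rewrite -subr_eq0; apply/eqP; rewrite -[RHS](eqP E) -addnn.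
by ring.
Qed.

Lemma fps_poly_natmul_eq0 (g : fps {poly rat}) n : g *+ n.+1 = 0 -> g = 0.
Proof.
move=> gn0; apply: fpsP => i; rewrite fps_coef0; apply/eqP.
have /eqP := congr1 (fun h : fps {poly rat} => h i) gn0.
by rewrite fps_coef0 fps_coefMn -scaler_nat scaler_eq0 pnatr_eq0.
Qed.

(* The product is killed by the Euler operator, so it is its own constant
   term. *)
Lemma bin_sq_gf_sqr : bin_sq_gf ^+ 2 * radicand = 1.
Proof.
rewrite (@fps_theta_eq0 _ (bin_sq_gf ^+ 2 * radicand)).
- have e : bin_sq_gf ^+ 2 * radicand =
      fps_const ((1 - Y) ^+ 2) * bin_sq_gf ^+ 2 +
      Z * ((Z - fps_const (2 * (1 + Y))) * bin_sq_gf ^+ 2).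
    by rewrite /radicand; ring.
  rewrite e fps_coefD fps_coef_XM0 fps_coef_constM addr0 expr2.
  rewrite fps_coefM big_ord1 /= subn0.
  have -> : (1 - Y) ^+ 2 * (bin_sq_gf 0%N * bin_sq_gf 0%N) =
    ((1 - Y) * bin_sq_gf 0%N) ^+ 2 by ring.
  by rewrite bin_sq_gf0 expr1n.
- exact: fps_poly_natmul_eq0.
rewrite expr2 !fps_thetaM.
have -> : fps_theta radicand =
    - (Z * fps_const (2 * (1 + Y))) + Z * Z + Z * Z.
  rewrite /radicand -mulrN -fps_constN !fps_thetaD !fps_thetaM.
  by rewrite !fps_theta_X !fps_theta_const; rewrite fps_constN; ring.
have -> : fps_const (2 * (1 + Y)) = 2 * fps_const (1 + Y).
  by rewrite -[2]mulr1 -mulrA mulr2n !mulrDl !mul1r fps_constD.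
move: radicand_theta_bin_sq_gf; set u := fps_theta _ => E.
(* The Euler operator sends [radicand] to -2 Z (1 + Y - Z), so the product rule leaves a multiple of
   the difference of the two sides of the differential equation. *)
transitivity (bin_sq_gf * 2 *
    (radicand * u - Z * (fps_const (1 + Y) - Z) * bin_sq_gf)).
  by ring.
by rewrite E subrr mulr0.
Qed.

(** * Pairs of weakly increasing sequences *)

(* The sum of 'X ^+ #{i | l_i = r_i} over the pairs of weakly increasing
   sequences of length m in nat whose last terms are at most A and B. *)
Fixpoint pair_wt m A B : {poly rat} :=
  if m is m'.+1 then
    \sum_(x < A.+1) \sum_(y < B.+1) 'X ^+ (x == y :> nat) * pair_wt m' x y
  else 1.

(* The number of weakly increasing sequences of length k in {h, ..., n},
   except that it is 0, even for k = 0, when n < h. *)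
Definition nb_incr (n h k : nat) : nat :=
  if (h <= n)%N then 'C(n - h + k, k) else 0.

(** Here [x] is the last term of the longer sequence. The value 0 below [h] is what forces [h <= x]
    when [k = 0]. The induction is Pascal's rule. *)
Lemma nb_incr_sum n h k :
  (\sum_(x < n.+1) nb_incr x h k)%N = nb_incr n h k.+1.
Proof.
elim: n => [|n IHn].
  rewrite big_ord1 /nb_incr; case: h => [|h] //=.
  by rewrite !add0n !binn.
rewrite big_ord_recr /= IHn /nb_incr; have [lehn|ltnh] := leqP h n.
  rewrite leqW // subSn // !addSn !addnS.
  by rewrite [in RHS]binS.
have [lehn|//] := leqP h n.+1.
have -> : h = n.+1 by apply/eqP; rewrite eqn_leq lehn.
by rewrite subnn !add0n !binn.
Qed.

(** At length 0 the two [nb_incr] are the indicators of [h <= A] and [h <= B], which gives the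
    diagonal the shape of a summand of [pair_wtE]. *)
Lemma sum_diag (P : nat -> {poly rat}) N A B : (A < N)%N -> (B < N)%N ->
  \sum_(x < A.+1) \sum_(y < B.+1) P x *+ (x == y :> nat) =
  \sum_(h < N) P h * (nb_incr A h 0 * nb_incr B h 0)%:R.
Proof.
move=> ltAN ltBN.
rewrite (big_ord_widen N (fun x => \sum_(y < B.+1) P x *+ (x == y))) //.
rewrite big_mkcond; apply: eq_bigr => x _.
rewrite /nb_incr !bin0 ltnS; case: (x <= A)%N; last by rewrite mulr0.
rewrite mul1n; case: leqP => [lexB|ltBx].
  rewrite (bigD1 (Ordinal (lexB : x < B.+1)%N)) //= eqxx mulr1 big1 ?addr0 //.
  by move=> y; rewrite -val_eqE /= eq_sym => /negbTE->.
rewrite mulr0 big1 // => y _; rewrite gtn_eqF //.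
by apply: leq_ltn_trans ltBx; rewrite -ltnS.
Qed.

(* The sum over j and h runs over the last marked symmetric index j + 1, with
   l_(j+1) = r_(j+1) = h. *)
Lemma pair_wtE m N A B : (A < N)%N -> (B < N)%N ->
  pair_wt m A B = (nb_incr A 0 m * nb_incr B 0 m)%:R + ('X - 1) *
    \sum_(j < m) \sum_(h < N) pair_wt j h h *
      (nb_incr A h (m - j.+1) * nb_incr B h (m - j.+1))%:R.
Proof.
move=> ltAN ltBN.
have sum_nb A' B' h k :
  \sum_(x < A'.+1) \sum_(y < B'.+1) (nb_incr x h k * nb_incr y h k)%:R =
  (nb_incr A' h k.+1 * nb_incr B' h k.+1)%:R :> {poly rat}.
  rewrite -!nb_incr_sum big_distrlr natr_sum; apply: eq_bigr => x _.
  by rewrite natr_sum.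
elim: m A B ltAN ltBN => [|m IHm] A B ltAN ltBN.
  by rewrite big_ord0 mulr0 addr0 /nb_incr !bin0.
(* Writing ['X] as [1 + ('X - 1)] splits off the pairs marked at their last index. *)
transitivity (\sum_(x < A.+1) \sum_(y < B.+1) pair_wt m x y +
    ('X - 1) * \sum_(x < A.+1) \sum_(y < B.+1)
      pair_wt m x x *+ (x == y :> nat)).
  rewrite mulr_sumr -big_split; apply: eq_bigr => x _ /=.
  rewrite mulr_sumr -big_split; apply: eq_bigr => y _ /=.
  case: eqP => [->|_]; last by rewrite mulr0 mul1r addr0.
  by rewrite expr1 mulr1n mulrBl mul1r addrC subrK.
(* The diagonal part is the summand [j = m], where nothing follows the marked index; the induction
   hypothesis and [sum_nb] give the others. *)
rewrite (sum_diag (fun h => pair_wt m h h) ltAN ltBN).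
rewrite [in RHS]big_ord_recr /= subnn mulrDr addrA; congr (_ + _).
transitivity (\sum_(x < A.+1) \sum_(y < B.+1)
   ((nb_incr x 0 m * nb_incr y 0 m)%:R + ('X - 1) *
    \sum_(j < m) \sum_(h < N) pair_wt j h h *
      (nb_incr x h (m - j.+1) * nb_incr y h (m - j.+1))%:R)).
  apply: eq_bigr => x _; apply: eq_bigr => y _; apply: IHm.
    by rewrite (leq_trans _ ltAN) // ltnS -ltnS.
  by rewrite (leq_trans _ ltBN) // ltnS -ltnS.
under [LHS]eq_bigr do rewrite big_split /=.
rewrite big_split /= sum_nb; congr (_ + _).
under [LHS]eq_bigr do rewrite -mulr_sumr exchange_big /=.
rewrite -mulr_sumr exchange_big; congr (_ * _); apply: eq_bigr => j _.
under [LHS]eq_bigr do rewrite exchange_big /=.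
rewrite exchange_big; apply: eq_bigr => h _.
under [LHS]eq_bigr do rewrite -mulr_sumr.
by rewrite -mulr_sumr sum_nb subSS subnSK.
Qed.

Definition pair_gf : fps (fps {poly rat}) :=
  Fps (fun m => Fps (fun n => pair_wt m n n)).

Lemma pair_gf_coef m n : pair_gf m n = pair_wt m n n. Proof. by []. Qed.

(** Case [A = B = n] of [pair_wtE]: the tails after the marked index contribute
    [bin_sq (m - j.+1) (n - h)], so the double sum is a Cauchy product in both variables, and [Z]
    accounts for the marked index itself. *)
Lemma pair_gfE :
  pair_gf = bin_sq_gf +
    fps_const (fps_const ('X - 1)) * (Z * (pair_gf * bin_sq_gf)).
Proof.
apply: fpsP => m; rewrite fps_coefD fps_coef_constM; apply: fpsP => n.
rewrite fps_coefD fps_coef_constM pair_gf_coef bin_sq_gf_coef.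
rewrite (pair_wtE m (ltnSn n) (ltnSn n)); congr (_ + _ * _).
  by rewrite mulnn /bin_sq /nb_incr subn0 addnC.
case: m => [|m]; first by rewrite big_ord0 fps_coef_XM0 fps_coef0.
rewrite fps_coef_XMS fps_coefM.
rewrite fps_coef_sum; apply: eq_bigr => j _; rewrite fps_coefM.
apply: eq_bigr => h _.
rewrite pair_gf_coef bin_sq_gf_coef /bin_sq /nb_incr subSS -ltnS ltn_ord.
by rewrite mulnn addnC.
Qed.

(** * Peeling off the outermost columns of a bargraph *)

Local Open Scope nat_scope.

Definition ascent h (a : seq nat) : nat := count is_N (boundary_from h a).

Lemma ascent_cons h b a : ascent h (b :: a) = (b - h) + ascent b a.
Proof.
by rewrite /ascent /= !count_cat !count_nseq /= mul1n mul0n.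
Qed.

Lemma ascent_nil h : ascent h [::] = 0.
Proof. by rewrite /ascent /= count_nseq. Qed.

Lemma ascent_rcons h a y : ascent h (rcons a y) = ascent h a + (y - last h a).
Proof.
elim: a h => [|b a IHa] h /=; first by rewrite ascent_cons !ascent_nil addnC.
by rewrite !ascent_cons IHa addnA.
Qed.

Lemma last_leq_ascent h a : last h a <= h + ascent h a.
Proof.
elim: a h => [|b a IHa] h /=; first by rewrite leq_addr.
by rewrite ascent_cons; have := IHa b; lia.
Qed.

Lemma num_E_size a : num_E a = size a.
Proof.
rewrite /num_E /boundary; elim: a 0 => [|b a IHa] h /=.
  by rewrite count_nseq.
by rewrite !count_cat !count_nseq /= IHa.
Qed.

Lemma column_last a : column a (size a) = last 0 a.
Proof. exact: nth_last. Qed.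

Lemma column1_leq_num_N a : column a 1 <= num_N a.
Proof.
case: a => [|b a]; first by [].
by rewrite -[num_N _]/(ascent 0 (b :: a)) ascent_cons subn0 leq_addr.
Qed.

Lemma last_leq_num_N a : last 0 a <= num_N a.
Proof. exact: last_leq_ascent. Qed.

Section Wrap.
Variables (x y : nat) (a : seq nat).
Let k := size a.
Let b := x :: rcons a y.

Lemma size_wrap : size b = k.+2. Proof. by rewrite /= size_rcons. Qed.

Lemma column_wrap i : 0 < i <= k -> column b i.+1 = column a i.
Proof.
case: i => // i /andP[_ ltik]; rewrite /column /= nth_rcons.
by rewrite ltik.
Qed.

Lemma column_wrap_last : column b k.+2 = y.
Proof. by rewrite /column /= nth_rcons ltnn eqxx. Qed.

Lemma deg_sym_wrap : deg_sym b = (x == y) + deg_sym a.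
Proof.
rewrite /deg_sym size_wrap -/k; set F := fun i => _.
have -> : k.+2./2 = k./2.+1 by [].
rewrite /= {1}/F subn1 column_wrap_last; congr (_ + _).
rewrite -[2]addn1 iotaDl count_map; apply: eq_in_count => i.
rewrite mem_iota => /andP[i1 ik].
have leik : i <= k by lia.
rewrite /F /= add1n column_wrap ?i1 //.
by rewrite subSS subSn ?leqW // column_wrap //; lia.
Qed.

(** Wrapping shifts both midpoints by one, so the only new conditions are the comparisons at the two
    ends. They need a nonempty interior: two columns alone are not compared with anything. *)
Lemma unimodal_wrap : 0 < k ->
  centered_unimodal b <->
  [/\ 0 < x <= column a 1, 0 < y <= last 0 a & centered_unimodal a].
Proof.
move=> k0; rewrite -column_last -/k /centered_unimodal size_wrap -/k.
have pos : all (leq 1) b = [&& 0 < x, 0 < y & all (leq 1) a].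
  by rewrite /= all_rcons.
have hk : k.+3./2 = k.+1./2.+1 by [].
have uk : uphalf k.+3 = (uphalf k.+1).+1 by [].
have c1 : column b 1 = x by [].
have ck := column_wrap_last.
rewrite /composition pos; split.
  move=> [[_ /and3P[x0 y0 a0]] up dn]; split.
  - by rewrite x0 -c1 -(@column_wrap 1) // up //; lia.
  - by rewrite y0 -ck -(@column_wrap k) ?k0 ?leqnn // dn //; lia.
  split; first by split=> // a_nil; rewrite /k a_nil in k0.
  - move=> i ib; rewrite -!column_wrap; try lia.
    by apply: up; lia.
  - move=> i ib; rewrite -!column_wrap; try lia.
    by apply: dn; lia.
move=> [/andP[x0 xa] /andP[y0 ya] [[_ a0] up dn]].
split; first by split=> //; apply/and3P.
- case=> // -[|i] ib; first by rewrite c1 column_wrap ?k0.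
  by rewrite !column_wrap; [apply: up| |]; lia.
- case=> // i ib; have [->|neik] := eqVneq i k.
    by rewrite ck column_wrap ?k0 ?leqnn.
  by rewrite !column_wrap; [apply: dn| |]; lia.
Qed.

(** Stopping at height [x] on the way up to the first column of [a] costs no extra ascent, and the
    final step to [y] goes down. *)
Lemma num_N_wrap : 0 < k -> x <= column a 1 -> y <= last 0 a ->
  num_N b = num_N a.
Proof.
rewrite /k -![num_N _]/(ascent 0 _) /b; case: a => // c a' _ /= xc ya.
rewrite -rcons_cons !ascent_cons ascent_rcons /=.
by rewrite /column /= in xc; lia.
Qed.

End Wrap.

(* The centered unimodal bargraphs with k columns, outer columns of heights at
   least M - A and M - B, and maximal height at most M, or equal to M when k is
   odd. Counting heights down from M makes the recursion that of [pair_wt]. *)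
Fixpoint unimodal_enum M k A B : seq (seq nat) :=
  match k with
  | 0 => [:: [::]]
  | 1 => [:: [:: M]]
  | k'.+2 => [seq (M - p.1) :: rcons a (M - p.2) |
      p <- [seq (u, v) | u <- index_iota 0 A.+1, v <- index_iota 0 B.+1],
      a <- unimodal_enum M k' p.1 p.2]
  end.

(** Induction peeling two columns at a time. The bounds on [A] and [B] keep all heights positive;
    for odd [k] the innermost column is [M], whence the exact value of [num_N]. *)
Lemma mem_unimodal_enum M k A B a : 0 < k -> A < M -> B < M ->
  a \in unimodal_enum M k A B <->
  [/\ size a = k, centered_unimodal a,
      M - A <= column a 1, M - B <= last 0 a &
      if odd k then num_N a = M else num_N a <= M].
Proof.
elim/ltn_ind: k A B a => -[|[|k]] // IHk A B a _ ltAM ltBM.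
  rewrite inE; split.
    move=> /eqP ->; split; rewrite ?leq_subr //=.
      split; [split=> //= | by case=> [|[]] | by case=> [|[]]].
      by rewrite andbT (leq_ltn_trans _ ltAM).
    by rewrite -[num_N _]/(ascent 0 _) ascent_cons ascent_nil; lia.
  move=> [sa [[_ _] _ _] _ _]; case: a sa => // c [] // _.
  by rewrite -[num_N _]/(ascent 0 _) ascent_cons ascent_nil subn0 addn0 => ->.
have memE x y c : x :: rcons c y \in unimodal_enum M k.+2 A B <->
    [/\ M - A <= x <= M, M - B <= y <= M &
        c \in unimodal_enum M k (M - x) (M - y)].
  split.
    move=> /allpairsPdep[[u v] [c' [/allpairsP[[u' v'] /= []]]]].
    rewrite !mem_index_iota => uA vB [-> ->] cu [-> /rcons_inj[-> ->]].
    by rewrite !subKn; try (split=> //); lia.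
  move=> [xA yB cu]; apply/allpairsPdep; exists (M - x, M - y), c.
  split=> //; last by rewrite /= !subKn //; lia.
  by apply: allpairs_f; rewrite mem_index_iota; lia.
have lastE x y c : last 0 (x :: rcons c y) = y by rewrite /= last_rcons.
have [[x [y [c ->]]]|nwrap] : (exists x y c, a = x :: rcons c y) \/
    ~ (exists x y c, a = x :: rcons c y).
- case: a => [|x a]; first by right=> -[? [? []]].
  case: (lastP a) => [|c y]; first by right=> -[? [? [[|? ?] []]]].
  by left; exists x, y, c.
- rewrite memE size_wrap lastE -[column (x :: _) 1]/x.
  (* With two columns the interior is empty and the wrapping lemmas do not apply. *)
  case: k => [|k] in IHk {memE} *.
    rewrite inE; split.
      move=> [xA yB /eqP->]; split=> //; try lia.
        split; last by case=> [|[]].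
          by split=> //=; lia.
        by case=> [|[|i]] //=; lia.
      rewrite -[num_N _]/(ascent 0 _) !ascent_cons ascent_nil /=; lia.
    move=> [[/size0nil->]].
    rewrite -[num_N _]/(ascent 0 _) !ascent_cons ascent_nil /= => _ xA yB N.
    by split=> //; lia.
  have oddE : odd k.+3 = odd k.+1 by rewrite /= negbK.
  split.
    move=> [xA yB]; rewrite IHk //; try lia.
    rewrite !subKn; try lia.
    move=> [sc cu xc yc N]; have k0 : 0 < size c by rewrite sc.
    split; rewrite ?sc //; try lia.
      by apply/(unimodal_wrap _ _ k0); split=> //; lia.
    by rewrite num_N_wrap // oddE.
  move=> [[sc] cu xA yB]; have k0 : 0 < size c by rewrite sc.
  move: cu => /(unimodal_wrap _ _ k0)[/andP[x0 xc] /andP[y0 yc] cu].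
  rewrite num_N_wrap // oddE => N.
  (* The outer heights are thus at most [M], so the truncated [M - x] and [M - y] are true
     differences. *)
  have leNM : num_N c <= M by move: N; rewrite /=; case: ifP => // _ ->.
  have := column1_leq_num_N c; have := last_leq_num_N c => ? ?.
  split; try lia.
  by rewrite IHk //; try lia; rewrite !subKn; try lia; split.
split.
  move=> /allpairsPdep[p [c [_ _ aE]]]; case: nwrap.
  by exists (M - p.1), (M - p.2), c.
case: a nwrap => [_ [] //|x a]; case: (lastP a) => [_ [] //|c y []].
by exists x, y, c.
Qed.

(** The depths stay below [M], where truncated subtraction from [M] is injective. *)
Lemma unimodal_enum_uniq M k A B : A < M -> B < M ->
  uniq (unimodal_enum M k A B).
Proof.
elim/ltn_ind: k A B => -[|[|k]] // IHk A B ltAM ltBM.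
have mem_p (p : nat * nat) :
    p \in [seq (u, v) | u <- index_iota 0 A.+1, v <- index_iota 0 B.+1] ->
    p.1 < M /\ p.2 < M.
  case/allpairsP=> -[u v] /=; rewrite !mem_index_iota => -[uA vB -> /=].
  by split; lia.
apply: allpairs_uniq_dep.
- by apply: allpairs_uniq; rewrite ?iota_uniq // => -[? ?] [? ?].
- by move=> p /mem_p[p1 p2]; apply: IHk.
move=> [p c] [q d] /allpairsPdep[p' [c' [/mem_p[p1 p2] _ pE]]].
move=> /allpairsPdep[q' [d' [/mem_p[q1 q2] _ qE]]].
have {pE} [pp _] : p = p' /\ True by case: pE.
have {qE} [qq _] : q = q' /\ True by case: qE.
move=> /= [e1 /rcons_inj[-> e2]].
suff -> : p = q by [].
move: p1 p2 q1 q2; rewrite -pp -qq; case: p e1 e2 {pp} => a1 a2.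
by case: q {qq} => b1 b2 /= *; congr (_, _); lia.
Qed.

(** * Coefficients of the bargraph series *)

Local Open Scope ring_scope.

(** Two outer columns have equal heights exactly when their depths below [M] agree, so both
    recursions coincide; a central column adds nothing to [deg_sym]. *)
Lemma sum_unimodal_enum M k A B : (A < M)%N -> (B < M)%N ->
  \sum_(a <- unimodal_enum M k A B) 'X ^+ deg_sym a = pair_wt k./2 A B.
Proof.
elim/ltn_ind: k A B => -[|[|k]] IHk A B ltAM ltBM.
- by rewrite big_seq1.
- by rewrite big_seq1.
rewrite big_allpairs_dep big_allpairs_dep /= big_mkord.
apply: eq_bigr => x _; rewrite big_mkord; apply: eq_bigr => y _ /=.
have ltxM : (x < M)%N by rewrite (leq_ltn_trans _ ltAM) // -ltnS.
have ltyM : (y < M)%N by rewrite (leq_ltn_trans _ ltBM) // -ltnS.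
rewrite -IHk // mulr_sumr; apply: eq_bigr => a _.
rewrite deg_sym_wrap exprD; congr ('X ^+ nat_of_bool _ * _).
by apply/eqP/eqP; lia.
Qed.

Arguments unimodal_enum : simpl never.

Lemma monomial_coef d e n i j :
  ((var_s ^+ d * var_x ^+ e * var_y ^+ n : series_xy) i) j =
  if (e == i) && (n == j) then 'X ^+ d else 0.
Proof.
have -> : (var_s ^+ d * var_x ^+ e * var_y ^+ n : series_xy) =
    fps_const (fps_const ('X ^+ d)) * (Z ^+ e * fps_const (Y ^+ n)).
  by rewrite mulrA !fps_const_exp.
rewrite fps_coef_constM fps_coef_constM fps_coef_XnM.
case: leqP => [leei|ltie]; last by rewrite fps_coef0 mulr0 gtn_eqF.
case: eqVneq => [->|neei]; last first.
  case: (i - e)%N (subn_gt0 e i) => [|k _]; last by rewrite fps_coef0 mulr0.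
  by move=> /esym; rewrite ltn_neqAle neei leei.
rewrite subnn /= -[Y ^+ n]mulr1 fps_coef_XnM.
case: leqP => [lenj|ltjn]; last by rewrite mulr0 gtn_eqF.
rewrite fps_coef1 subn_eq0; case: eqVneq => [->|nenj].
  by rewrite leqnn mulr1.
by rewrite leqNgt ltn_neqAle nenj lenj mulr0.
Qed.

(** Only the bargraphs in [L] have a nonzero term at x ^ i y ^ j, so the infinite family reduces to
    a finite sum. *)
Lemma centered_unimodal_gf_coef i j (L : seq (seq nat)) : uniq L ->
  (forall a, a \in L <->
     [/\ size a = i, centered_unimodal a & num_N a = j]) ->
  (centered_unimodal_gf : series_xy) i j = \sum_(a <- L) 'X ^+ deg_sym a.
Proof.
move=> uL memL; rewrite /centered_unimodal_gf /series_sum /=.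
rewrite -(@fsbig_widen _ _ _ _ [set` L]%classic); first last.
- move=> a [cu aL]; rewrite /= monomial_coef.
  case: andP => // -[/eqP Ea /eqP Na]; case: aL.
  by apply: (proj2 (memL a)); split=> //; rewrite -num_E_size.
- by move=> a aL; have [] := proj1 (memL a) aL.
rewrite -fsbig_seq //; apply: eq_big_seq => a /memL[sa _ Na].
by rewrite monomial_coef num_E_size sa Na !eqxx.
Qed.

Lemma centered_unimodal_column1_gt0 a :
  centered_unimodal a -> (0 < column a 1)%N.
Proof. by case: a => [[[]]|c a [[_ /= /andP[]]]]. Qed.

Lemma centered_unimodal_last_gt0 a : centered_unimodal a -> (0 < last 0 a)%N.
Proof.
case: a => [[[]] //|c a [[_ /allP a0] _ _]].
by apply: a0; rewrite /= mem_last.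
Qed.

Lemma centered_unimodal_num_N_gt0 a : centered_unimodal a -> (0 < num_N a)%N.
Proof.
move=> cu; apply: leq_trans (last_leq_num_N a).
exact: centered_unimodal_last_gt0.
Qed.

Lemma mem_unimodal_enum_diag n k a : (0 < k)%N ->
  a \in unimodal_enum n.+1 k n n <->
  [/\ size a = k, centered_unimodal a &
      if odd k then num_N a = n.+1 else (num_N a <= n.+1)%N].
Proof.
move=> k0; rewrite mem_unimodal_enum // subSnn; split=> [[]//|[sa cu N]].
by split; rewrite ?centered_unimodal_column1_gt0 ?centered_unimodal_last_gt0.
Qed.

Local Notation gf := (centered_unimodal_gf : series_xy).

Lemma gf_coefn0 i : gf i 0%N = 0.
Proof.
rewrite (@centered_unimodal_gf_coef _ _ [::]) ?big_nil // => a.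
by split=> // -[_ /centered_unimodal_num_N_gt0 + N0]; rewrite N0.
Qed.

Lemma gf_coef0n j : gf 0%N j = 0.
Proof.
rewrite (@centered_unimodal_gf_coef _ _ [::]) ?big_nil // => a.
by split=> // -[/size0nil-> [[]]].
Qed.

Lemma gf_coef_odd m n : gf m.*2.+1 n.+1 = pair_wt m n n.
Proof.
rewrite (@centered_unimodal_gf_coef _ _ (unimodal_enum n.+1 m.*2.+1 n n)).
- by rewrite sum_unimodal_enum // [_./2](half_bit_double m true).
- exact: unimodal_enum_uniq.
by move=> a; rewrite mem_unimodal_enum_diag // [odd _]/= odd_double.
Qed.

Lemma gf_coef_even_sum m n :
  gf m.+1.*2 n.+1 =
  \sum_(a <- unimodal_enum n.+1 m.+1.*2 n n | num_N a == n.+1)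
    'X ^+ deg_sym a.
Proof.
rewrite -big_filter; apply: centered_unimodal_gf_coef.
  by rewrite filter_uniq // unimodal_enum_uniq.
move=> a; rewrite mem_filter; split.
  move=> /andP[/eqP Na]; rewrite mem_unimodal_enum_diag //.
  by case=> sa cu _.
move=> [sa cu Na]; rewrite Na eqxx mem_unimodal_enum_diag // odd_double.
by rewrite Na.
Qed.

Lemma gf_coef_even1 m : gf m.+1.*2 1%N = pair_wt m.+1 0 0.
Proof.
rewrite gf_coef_even_sum -{2}(doubleK m.+1) -(@sum_unimodal_enum 1) //.
rewrite [RHS](bigID (fun a => num_N a == 1%N)) /=.
rewrite [X in _ = _ + X]big1_seq ?addr0 // => a /andP[Na].
move=> /(@mem_unimodal_enum_diag 0 m.+1.*2 a isT).
rewrite odd_double => -[_ cu].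
by have := centered_unimodal_num_N_gt0 cu; case: (num_N a) Na => [|[]].
Qed.

(** Without a central column the enumeration only bounds the maximum; maximum exactly [n.+2] is the
    difference of two consecutive bounds. *)
Lemma gf_coef_even m n :
  gf m.+1.*2 n.+2 = pair_wt m.+1 n.+1 n.+1 - pair_wt m.+1 n n.
Proof.
have perm : perm_eq
    [seq a <- unimodal_enum n.+2 m.+1.*2 n.+1 n.+1 | num_N a != n.+2]
    (unimodal_enum n.+1 m.+1.*2 n n).
  apply: uniq_perm; rewrite ?filter_uniq ?unimodal_enum_uniq //.
  move=> a; rewrite mem_filter; apply/andP/idP.
    rewrite mem_unimodal_enum_diag // => -[Na [sa cu]].
    rewrite odd_double => leN; rewrite mem_unimodal_enum_diag //.
    by rewrite odd_double; split=> //; move: leN; rewrite leq_eqVlt (negbTE Na).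
  rewrite mem_unimodal_enum_diag // odd_double => -[sa cu leN].
  rewrite mem_unimodal_enum_diag // odd_double ltn_eqF //.
  by split=> //; split=> //; apply: leqW.
rewrite gf_coef_even_sum -{2 3}(doubleK m.+1).
rewrite -(@sum_unimodal_enum n.+2) // -(@sum_unimodal_enum n.+1) //.
rewrite [X in _ = X - _](bigID (fun a => num_N a == n.+2)) /=.
by rewrite -[X in _ = _ + X - _]big_filter (perm_big _ perm) addrK.
Qed.

(** Even lengths give y (1 - y) F, the factor 1 - y taking the differences in the height bound, and
    odd lengths give x y F. The final - y removes the empty sequence: at x ^ 0 the series F is 1 /
    (1 - y). *)
Lemma centered_unimodal_gfE :
  centered_unimodal_gf =
  var_y * (1 + var_x - var_y) * fps_dilate pair_gf - var_y.
Proof.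
set F := fps_dilate pair_gf.
have -> : var_y * (1 + var_x - var_y) * F - var_y =
    fps_const (Y * (1 - Y)) * F + fps_X _ * (fps_const Y * F) - fps_const Y.
  rewrite fps_constM fps_constD fps_constN fps_const1 -/var_y -/var_x.
  by ring.
apply: fps_parityP => m; apply: fpsP => j.
  rewrite !fps_coefD !fps_coefN fps_coef_constM fps_dilate_doubleE.
  have -> : (fps_X (fps {poly rat}) * (fps_const Y * F)) m.*2 = 0.
    case: m => [|m]; first by rewrite fps_coef_XM0.
    by rewrite doubleS fps_coef_XMS fps_coef_constM fps_dilate_oddE mulr0.
  rewrite fps_coef0 addr0 -mulrA mulrBl mul1r.
  case: j => [|j]; first rewrite gf_coefn0 fps_coef_XM0.
    by case: m => [|m] /=; rewrite sub0r oppr0.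
  rewrite fps_coef_XMS fps_coefD fps_coefN.
  case: m => [|m].
    rewrite gf_coef0n -[fps_const Y 0.*2]/Y; case: j => [|j].
      by rewrite fps_coef_XM0 pair_gf_coef /= subr0 subrr.
    by rewrite fps_coef_XMS !pair_gf_coef /= subrr subr0.
  rewrite -[fps_const Y m.+1.*2]/0 fps_coef0 subr0; case: j => [|j].
    by rewrite fps_coef_XM0 subr0 gf_coef_even1.
  by rewrite fps_coef_XMS gf_coef_even.
rewrite !fps_coefD !fps_coefN fps_coef_constM fps_dilate_oddE.
rewrite mulr0 fps_coef0 add0r fps_coef_XMS fps_coef_constM fps_dilate_doubleE.
rewrite subr0.
case: j => [|j]; first by rewrite gf_coefn0 fps_coef_XM0.
by rewrite fps_coef_XMS gf_coef_odd.
Qed.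

(* D is the square root: the unique series with constant term 1 whose square is
   the radicand. *)
Theorem theorem5p1 :
  exists D : series_xy,
    unique (fun D' : series_xy =>
        D' ^+ 2 = ((var_x + 1) ^+ 2 - var_y) * ((var_x - 1) ^+ 2 - var_y)
        /\ D' 0%N 0%N = 1) D
    /\ centered_unimodal_gf =
       var_y * (1 + var_x - var_y) / ((1 - var_s) * var_x ^+ 2 + D) - var_y.
Proof.
pose G : series_xy := fps_dilate bin_sq_gf.
pose F : series_xy := fps_dilate pair_gf.
have G00 : G 0%N 0%N = 1 by rewrite /= /bin_sq bin0.
have unitE (f : series_xy) :
    (f \is a GRing.unit) = (f 0%N 0%N \is a GRing.unit).
  by rewrite [LHS]fps_unitE fps_unitE.
have uG : G \is a GRing.unit by rewrite unitE G00 unitr1.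
have coef00 (f g : series_xy) : (f * g) 0%N 0%N = f 0%N 0%N * g 0%N 0%N.
  by rewrite fps_coefM big_ord1 subn0 fps_coefM big_ord1 subn0.
have radE : fps_dilate radicand =
    ((var_x + 1) ^+ 2 - var_y) * ((var_x - 1) ^+ 2 - var_y) :> series_xy.
  rewrite /radicand !fps_dilateD fps_dilateN !fps_dilateM fps_dilate_X.
  rewrite !fps_dilate_const -/var_x !(fps_constM, fps_constD, fps_constN).
  rewrite fps_const1 -/var_y.
  by ring.
have sqrG : G ^+ 2 *
    (((var_x + 1) ^+ 2 - var_y) * ((var_x - 1) ^+ 2 - var_y)) = 1.
  rewrite -radE expr2 /G -!fps_dilateM -expr2 bin_sq_gf_sqr.
  by rewrite -fps_const1 fps_dilate_const.
have GV2 : G^-1 ^+ 2 =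
    ((var_x + 1) ^+ 2 - var_y) * ((var_x - 1) ^+ 2 - var_y).
  by rewrite exprVn; apply: mulr1_eq.
have GV00 : G^-1 0%N 0%N = 1.
  by have := coef00 G G^-1; rewrite divrr // G00 mul1r => <-.
exists G^-1; split.
  (* Two roots have a difference whose product with their sum is 0, and the sum is a unit because
     its constant term is 2. *)
  split=> // D [D2 D00]; apply/eqP; rewrite -subr_eq0.
  have uD : G^-1 + D \is a GRing.unit.
    rewrite unitE -[(G^-1 + D) 0%N 0%N]/(G^-1 0%N 0%N + D 0%N 0%N) GV00 D00.
    rewrite -mulr2n -polyC_natr.
    by rewrite rmorph_unit // unitfE pnatr_eq0.
  by rewrite -(inj_eq (mulIr uD)) mul0r -subr_sqr D2 GV2 subrr.
have s1E : fps_const (fps_const ('X - 1)) = var_s - 1.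
  by rewrite !fps_constD !fps_constN !fps_const1.
have FG : F = G + (var_s - 1) * (var_x ^+ 2 * (F * G)).
  rewrite {1}/F pair_gfE !fps_dilateD !fps_dilateM !fps_dilate_const.
  by rewrite fps_dilate_X s1E -/F -/G -/var_x.
have invF : ((1 - var_s) * var_x ^+ 2 + G^-1) * F = 1.
  (* The inserted factor [G * G^-1] matches the term that [FG] produces from [G^-1 * F], so the two
     cancel. *)
  have -> : ((1 - var_s) * var_x ^+ 2 + G^-1) * F =
      G^-1 * F + (1 - var_s) * var_x ^+ 2 * F * (G * G^-1).
    by rewrite divrr //; ring.
  by rewrite {1}FG -[RHS](mulVr uG); ring.
by rewrite centered_unimodal_gfE -/F (mulr1_eq invF).
Qed.
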